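(* Let $X$ be a Hausdorff space, let $\tau^c$ be the family of all closed subsets of $X$ and $\mathcal C_X$ the family of all compact subsets of $X$. Let $Y$ be a Hausdorff space with a strictly increasing closed cover $\{B_n\}_{n\in\mathbb N}$. For a map $\phi:\tau^c\to\mathcal L(X,\mathcal F(Y))$, $F\mapsto\phi_F$ (with $\phi_x:=\phi_{\{x\}}$ for $x\in X$), consider the properties: (i) for each $F\in\tau^c$, $F=\bigcap_{n\in\mathbb N}\phi_F^{-1}[Y\setminus B_n]$; (ii) if $F_1,F_2\in\tau^c$ and $F_1\subset F_2$, then $\phi_{F_1}(x)\subset\phi_{F_2}(x)$ for all $x\in X$; (iii) $\phi_x(y)=\phi_y(x)$ for all $x,y\in X$; (iv) for each $K\in\mathcal C_X$ and $F\in\tau^c$ with $K\cap F=\emptyset$, $\phi_K$ is bounded on $F$; (v) for each $F\in\tau^c$ and $K\in\mathcal C_X$ with $F\cap K=\emptyset$, $\phi_F$ is bounded on $K$. The following are equivalent. (a) $X$ is metrizable. (b) There exists a map $\phi:\tau^c\to\mathcal L(X,\mathcal F(Y))$ satisfying (i), (ii), (iii) and (iv). (c) There exists a map $\phi:\tau^c\to\mathcal L(X,\mathcal F(Y))$ satisfying (i), (ii), (iii) and (v). (d) There exists a map $\phi:\tau^c\to\mathcal L(X,\mathcal F(Y))$ satisfying (i), (ii), (iv) and (v).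
   Context: $\mathbb N$ is the set of positive integers. A sequence $\{B_n\}_{n\in\mathbb N}$ of closed subsets of a space $Y$ is a strictly increasing closed cover of $Y$ if $Y=\bigcup_{n}B_n$, $B_1\neq\emptyset$ and $B_n\subsetneq B_{n+1}$ for each $n$. $\mathcal F(Y)$ is the family of nonempty closed subsets of $Y$. For a set-valued map $\psi:X\to\mathcal F(Y)$ and $B\subset Y$, $\psi^{-1}[B]=\{x\in X:\psi(x)\cap B\neq\emptyset\}$ and $\psi^{\#}[B]=\{x\in X:\psi(x)\subset B\}$. $\psi$ is lower semi-continuous if $\psi^{-1}[V]$ is open in $X$ for each open $V\subset Y$; $\mathcal L(X,\mathcal F(Y))$ is the set of all lower semi-continuous maps $X\to\mathcal F(Y)$. $\psi$ is bounded on $A\subset X$ if $A\subset\psi^{\#}[B_n]$ for some $n\in\mathbb N$. Since $X$ is Hausdorff, compact subsets are closed, so $\phi_K$ makes sense for $K\in\mathcal C_X$. *)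

(* Defs.v *)
From mathcomp Require Import all_boot all_order all_algebra.
From mathcomp Require Import all_classical all_reals all_analysis.

Set Implicit Arguments.
Unset Strict Implicit.
Unset Printing Implicit Defensive.

Import Order.TTheory GRing.Theory Num.Theory.

Local Open Scope classical_set_scope.

Definition metrizable (R : realType) (X : topologicalType) : Prop :=
  exists (M : metricType R) (f : X -> M) (g : M -> X),
    [/\ cancel f g, cancel g f, continuous f & continuous g].

(* The sequence B_1, B_2, ... of the cover is indexed from 0. *)
Definition strictly_increasing_closed_cover (Y : topologicalType)
    (B : nat -> set Y) : Prop :=
  [/\ forall n, closed (B n),
      \bigcup_n B n = setT,
      B 0%N !=set0 &
      forall n, B n `<` B n.+1].

Section SetValuedMaps.
Variables X Y : topologicalType.
Implicit Types (psi : X -> set Y) (B : nat -> set Y).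

Definition weak_preimage psi (V : set Y) : set X :=
  [set x | psi x `&` V !=set0].

Definition strong_preimage psi (V : set Y) : set X :=
  [set x | psi x `<=` V].

Definition nonempty_closed_valued psi : Prop :=
  forall x, psi x !=set0 /\ closed (psi x).

Definition lower_semicontinuous_map psi : Prop :=
  forall V : set Y, open V -> open (weak_preimage psi V).

Definition bounded_map_on B psi (A : set X) : Prop :=
  exists n, A `<=` strong_preimage psi (B n).

(* A map from the closed subsets of X to the lower semi-continuous maps from X
   to the nonempty closed subsets of Y is represented by a function phi on all
   subsets of X. Only the values of phi on closed sets are constrained or used:
   below, phi is applied to closed sets, to singletons and to compact sets, and
   the last two are closed when X is Hausdorff. *)
Implicit Type phi : set X -> X -> set Y.

Definition closed_sets_to_lsc phi : Prop :=
  forall F, closed F ->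
    nonempty_closed_valued (phi F) /\ lower_semicontinuous_map (phi F).

Definition unbounded_exactly_on B phi : Prop :=
  forall F, closed F -> F = \bigcap_n weak_preimage (phi F) (~` B n).

Definition monotone_in_set phi : Prop :=
  forall F1 F2, closed F1 -> closed F2 -> F1 `<=` F2 ->
    forall x, phi F1 x `<=` phi F2 x.

Definition symmetric_on_points phi : Prop :=
  forall x y, phi [set x] y = phi [set y] x.

Definition compact_bounded_on_closed B phi : Prop :=
  forall K F, compact K -> closed F -> K `&` F = set0 ->
    bounded_map_on B (phi K) F.

Definition closed_bounded_on_compact B phi : Prop :=
  forall F K, closed F -> compact K -> F `&` K = set0 ->
    bounded_map_on B (phi F) K.

End SetValuedMaps.

(* Main.v *)
From HB Require Import structures.
Require Import Defs.
From mathcomp Require Import all_boot all_order all_algebra.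
From mathcomp Require Import all_classical all_reals all_analysis.

Set Implicit Arguments.
Unset Strict Implicit.
Unset Printing Implicit Defensive.

(** What links phi to the topology of X is the family of open sets
    W n F = phi_F^{-1}[Y \ B_n], which decrease with n.

    From a metric to phi: given a distance d on X, let W n F be the open
    (n + 1)^{-1}-thickening of F and let phi_F(x) be the intersection of the
    B_k over the k with x outside W k F. Since the cover is strictly
    increasing, phi_F^{-1}[Y \ B_n] is exactly W n F
    ([weak_preimage_cover_step]), so that (i) says that a closed set is the
    intersection of its thickenings, (iii) follows from the symmetry of d, and
    (iv) and (v) both say that disjoint compact and closed sets are at a positive
    distance ([exists_phi_of_distance]).

    From phi to a metric: put U_n(x) = phi_x^{-1}[Y \ B_n], an open
    neighbourhood of x by (i). By monotonicity, (iv) and (v) give, for each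
    compact K contained in an open set O and for some n,
      - under (iv): U_n(z) is contained in O for all z in K;
      - under (v): if U_n(y) meets K, then y lies in O.
    The symmetry (iii) exchanges these two conditions, so both hold in each of
    the cases (b), (c) and (d). Applied to a convergent sequence together with
    its limit, they become local at a point
    ([nbhs_of_compact_exhaustion]): for all x and n there is an m such that
    U_m(y) is contained in U_n(x) as soon as U_m(x) meets U_m(y). This is
    Frink's metrization criterion ([metrizable_Frink]): thinning out the bases
    point by point turns it into a decreasing sequence of symmetric entourages
    with E_{k+1} o E_{k+1} contained in E_k, hence into a pseudodistance, which separates points
    because X is Hausdorff. *)

Import Order.TTheory GRing.Theory Num.Theory.

Local Open Scope classical_set_scope.

(** * Distances from sequences of entourages *)

Section Distances.
Local Open Scope ring_scope.
Variables (R : realType) (X : choiceType).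

(** The sets E k form a countable base of a uniformity, and a countably based
    uniformity is pseudometrizable; the infimum of the radii of the balls
    around x that contain y is then a pseudodistance. The statement mentions only a
    function on X, so that the uniformity need not be reconciled with a
    topology that X may already carry. *)
Lemma distance_of_entourage_sequence (E : nat -> set (X * X)) :
  (forall k x, E k (x, x)) ->
  (forall k x y, E k (x, y) -> E k (y, x)) ->
  (forall k, (E k.+1 \; E k.+1 `<=` E k)%relation) ->
  exists d : X -> X -> R,
    [/\ forall x, d x x = 0, forall x y, d x y = d y x,
        forall y x z, d x z <= d x y + d y z,
        forall e, 0 < e -> exists k, forall x y, E k (x, y) -> d x y < e &
        forall k, exists2 e, 0 < e & forall x y, d x y < e -> E k (x, y)].
Proof.
case: X E => X' cX E Exx Esym Ecomp.
have Ele k l : (k <= l)%N -> E l `<=` E k.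
  move=> /subnK <-; elim: (l - k)%N => [//|j IH] [a b] Eab.
  by apply: IH; apply: Ecomp; exists b.
pose ent := filter_from setT E.
have ent_filter : Filter ent.
  apply: filter_from_filter; first by exists 0%N.
  move=> k l _ _; exists (maxn k l) => // ab Eab.
  by split; apply: Ele Eab; rewrite ?leq_maxl ?leq_maxr.
have ent_diag A : ent A -> (diagonal `<=` A)%relation.
  by move=> [k _ kA] [a b] ab; rewrite [a](ab : a = b); exact/kA/Exx.
have ent_inv A : ent A -> ent (A^-1)%relation.
  by move=> [k _ kA]; exists k => // -[a b] /Esym /kA.
have ent_split A : ent A -> exists2 C, ent C & (C \; C `<=` A)%relation.
  by move=> [k _ kA]; exists (E k.+1); [exists k.+1|exact: subset_trans kA].
pose T : uniformType := HB.pack X' cX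
  (isUniform.Build (Choice.Pack cX) ent_filter ent_diag ent_inv ent_split).
have cntT : countable_uniformity T.
  apply/countable_uniformityP; exists E; last by move=> k; exists k.
  by move=> A [k _ kA]; exists k.
pose P : pseudoMetricType R := countable_uniform.type cntT.
(* The balls of radius 2 are the whole space, so no distance is infinite. *)
have fin (xy : P * P) : edist xy \is a fin_num.
  apply/edist_finP; exists 2 => //.
  exact: (@countable_uniform.countable_uniform_bounded R T cntT).
exists (fun x y : X' => fine (edist ((x, y) : P * P))); split.
- by move=> x; rewrite edist_refl.
- by move=> x y; rewrite edist_sym.
- by move=> y x z; rewrite -lee_fin EFinD !fineK// edist_triangle.
- move=> e e0.
  have [k _ kE] : @entourage P [set xy | ball xy.1 (e / 2) xy.2].
    rewrite -(@entourage_ballE R P); exists (e / 2) => //=; exact: divr_gt0.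
  exists k => x y /kE xy; rewrite -lte_fin fineK//.
  rewrite (le_lt_trans (@edist_fin R P (e / 2) (x, y) _ xy)) ?divr_gt0//.
  by rewrite lte_fin ltr_pdivrMr// ltr_pMr// ltr1n.
- move=> k.
  have : @entourage P (E k) by exists k.
  rewrite -(@entourage_ballE R P) => -[e /= e0 eE].
  exists e => // x y xy; apply: eE => /=.
  by apply: (@edist_lt_ball R P e (x, y)); rewrite -[edist _]fineK// lte_fin.
Qed.

(** X is kept apart from its copy M because X may already be a topological
    space, whose neighbourhoods are not definitionally those of d. *)
Lemma metricType_of_distance (d : X -> X -> R) :
  (forall x, d x x = 0) -> (forall x y, d x y = 0 -> x = y) ->
  (forall x y, d x y = d y x) -> (forall y x z, d x z <= d x y + d y z) ->
  exists (M : metricType R) (f : X -> M) (g : M -> X),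
    [/\ cancel f g, cancel g f &
        forall x e, ball (f x) e = g @^-1` [set y | d x y < e]].
Proof.
case: X d => X' cX d dxx d0 dC dD.
pose M : metricType R := HB.pack X' cX
  (isMetric.Build R (Choice.Pack cX) dxx d0 dC dD).
exists M, id, id; split=> // x e; exact: (@ballEmdist R M).
Qed.

End Distances.

(** * Frink's metrization criterion *)

Section Frink.
Variables (R : realType) (X : topologicalType).

(** The index m granted for x and n depends on x, so the sets V y m do not
    themselves define entourages. Passing to a subsequence of the base at each
    point makes the condition uniform: if W x k.+1 meets W y k.+1, then both
    lie in W x k or both lie in W y k, according to which of x and y has the
    smaller index. The sets of pairs of points lying in a common W x k are then
    the required entourages. *)
Lemma metrizable_Frink (V : X -> nat -> set X) :
  hausdorff_space X ->
  (forall x n, nbhs x (V x n)) ->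
  (forall x m n, (m <= n)%N -> V x n `<=` V x m) ->
  (forall x A, nbhs x A -> exists n, V x n `<=` A) ->
  (forall x n, exists m, forall y, V x m `&` V y m !=set0 -> V y m `<=` V x n) ->
  metrizable R X.
Proof.
move=> hX Vnbhs Vle Vbase Vfrink.
have /choice[m mP] : forall xn : X * nat, exists m, forall y,
    V xn.1 m `&` V y m !=set0 -> V y m `<=` V xn.1 xn.2.
  by move=> [x n]; exact: Vfrink.
(* Taking idx x k >= k guarantees that the sets W x k shrink uniformly in x,
   which is what makes the entourages small near a given point. *)
pose idx x := fix idx k :=
  if k is k'.+1 then maxn (m (x, idx k')) k else 0%N.
have idx_ge x k : (k <= idx x k)%N by case: k => //= k; exact: leq_maxr.
pose W x k := V x (idx x k).
have WS x k y : W x k.+1 `&` W y k.+1 !=set0 -> (idx x k.+1 <= idx y k.+1)%N ->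
    W x k.+1 `|` W y k.+1 `<=` W x k.
  move=> [b [xb yb]] le_xy.
  have le_m : (m (x, idx x k) <= idx x k.+1)%N by exact: leq_maxl.
  have xm := Vle x _ _ le_m; have ym := Vle y _ _ (leq_trans le_m le_xy).
  rewrite subUset; split.
    by apply: (subset_trans xm); apply: (mP (x, _) x); exists b; split; apply: xm.
  by apply: (subset_trans ym); apply: (mP (x, _) y); exists b; split;
    [apply: xm|apply: ym].
pose E k : set (X * X) := \bigcup_x (W x k `*` W x k).
have Exx k x : E k (x, x).
  by exists x => //; split; exact: nbhs_singleton (Vnbhs _ _).
have Esym k a b : E k (a, b) -> E k (b, a) by move=> [x _ []]; exists x.
have Ecomp k : (E k.+1 \; E k.+1 `<=` E k)%relation.
  move=> [a c] [b [x _ [/= xa xb]] [y _ [/= yb yc]]].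
  have xy : W x k.+1 `&` W y k.+1 !=set0 by exists b.
  have [le_xy|/ltnW le_yx] := leqP (idx x k.+1) (idx y k.+1).
    by exists x => //; split; apply: (WS _ _ _ xy le_xy); [left|right].
  rewrite setIC in xy.
  by exists y => //; split; apply: (WS _ _ _ xy le_yx); [right|left].
have [d [dxx dC dD dE Ed]] := distance_of_entourage_sequence R Exx Esym Ecomp.
have nbhsP x A : nbhs x A <->
    exists2 e : R, (0 < e)%R & forall y, (d x y < e)%R -> A y.
  split=> [/Vbase[n nA]|[e /dE[k kE] eA]].
    have := mP (x, n); set j := m _ => jP.
    (* If x and y lie in W z j, then V z j meets V x j and contains y. *)
    have [e e0 eE] := Ed j; exists e => // y /eE[z _ [/= zx zy]].
    have zj := Vle z _ _ (idx_ge z j).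
    apply/nA/(jP z); last exact: zj.
    by exists x; split; [exact: nbhs_singleton (Vnbhs _ _)|exact: zj].
  apply: filterS (Vnbhs x (idx x k)) => y xy; apply/eA/kE.
  by exists x => //; split=> //; exact: nbhs_singleton (Vnbhs _ _).
have d0 x y : d x y = 0%R -> x = y.
  move=> xy0; apply: hX => A C /nbhsP[e e0 eA] yC; exists y.
  by split; [apply: eA; rewrite xy0|exact: nbhs_singleton].
have [M [f [g [fK gK fb]]]] := metricType_of_distance dxx d0 dC dD.
exists M, f, g; split=> // x A.
  move=> /nbhs_ballP[e e0 eA]; apply/nbhsP; exists e => // y xy.
  by apply: eA; rewrite fb/= fK.
move=> /nbhsP[e e0 eA]; apply/nbhs_ballP; exists e => // y.
by rewrite -{1}(gK x) fb => /eA.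
Qed.

End Frink.

(** * From compact sets to neighbourhoods *)

Section CompactToFrink.
Variable X : topologicalType.

(** A filter on this set that does not cluster at x lives on finitely many
    terms of the sequence. *)
Lemma compact_cvg_seq (z : nat -> X) (x : X) :
  z @ \oo --> x -> compact (x |` range z).
Proof.
move=> zx F FF FK.
have [xF|] := pselect (cluster F x); first by exists x; split => //; left.
move=> /existsNP[A] /existsNP[C] /not_implyP[FA] /not_implyP[xC AC0].
have [N _ NC] := zx _ xC.
have cptN : compact (z @` `I_N) by exact/finite_compact/finite_image/finite_II.
have FN : F (z @` `I_N).
  apply: filterS (filterI FA FK) => y [Ay xy].
  have nCy : ~ C y by move=> Cy; apply: AC0; exists y.
  case: xy => [yx|[n _ zy]]; first by case: nCy; rewrite yx; exact: nbhs_singleton.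
  exists n => //=; rewrite ltnNge; apply/negP => Nn.
  by apply: nCy; rewrite -zy; exact: NC.
have [y [[n _ zy] Fy]] := cptN F FF FN.
by exists y; split => //; right; exists n.
Qed.

(** At a point with a countable base, a property that holds with some index
    uniformly on compact sets holds with some index uniformly near the point:
    otherwise counterexamples z_i to index i, chosen in V i, would converge to
    x, and the compact set that they form with x would lie in no G n. *)
Lemma nbhs_of_compact_exhaustion (x : X) (V G : nat -> set X) (A : set X) :
  (forall m n, (m <= n)%N -> V n `<=` V m) ->
  (forall C, nbhs x C -> exists n, V n `<=` C) ->
  (forall m n, (m <= n)%N -> G m `<=` G n) ->
  nbhs x A ->
  (forall K, compact K -> K `<=` A -> exists n, K `<=` G n) ->
  exists n, V n `<=` G n.
Proof.
move=> Vle Vbase Gle xA AG; have [n0 n0A] := Vbase _ xA.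
apply: contrapT => /forallNP VG.
(* The sequence starts at n0, so that all of its terms lie in A. *)
have /choice[z zP] : forall i, exists z, V (n0 + i)%N z /\ ~ G (n0 + i)%N z.
  by move=> i; have /existsNP[z /not_implyP[]] := VG (n0 + i)%N; exists z.
have zx : z @ \oo --> x.
  move=> C /Vbase[n nC]; exists n => // i ni; apply: nC.
  have [zi _] := zP i; apply: Vle zi.
  exact: (leq_trans ni (leq_addl _ _)).
have [|n nG] := AG _ (compact_cvg_seq zx).
  move=> y [->|[i _ <-]]; first exact: nbhs_singleton.
  by have [zi _] := zP i; apply: n0A; apply: Vle zi; exact: leq_addr.
have [_ []] := zP n; apply: Gle (leq_addl n0 n) _ _.
by apply: nG; right; exists n.
Qed.

End CompactToFrink.

Section CompactUniform.
Variables (R : realType) (X : topologicalType).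

(** For z in both U x m and U y m, the second condition near x puts y close to
    x, and the first one, near x again, makes U y m small: this is Frink's
    criterion. *)
Lemma metrizable_compact_uniform_nbhs (U : X -> nat -> set X) :
  hausdorff_space X ->
  (forall x n, open (U x n)) ->
  (forall x n, U x n x) ->
  (forall x m n, (m <= n)%N -> U x n `<=` U x m) ->
  (forall K O, compact K -> open O -> K `<=` O ->
     exists n, K `<=` [set z | forall y, U z n y -> O y]) ->
  (forall K O, compact K -> open O -> K `<=` O ->
     exists n, K `<=` [set z | forall y, U y n z -> O y]) ->
  metrizable R X.
Proof.
move=> hX Uopen Uxx Ule Uout Uin.
have Unbhs x n : nbhs x (U x n) by exact: open_nbhs_nbhs.
have Ubase x A : nbhs x A -> exists n, U x n `<=` A.
  rewrite nbhsE => -[C [oC Cx] CA].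
  have [|n nC] := Uout [set x] C (@compact_set1 _ x) oC; first by move=> _ ->.
  by exists n => y xy; apply/CA/(nC x).
apply: (@metrizable_Frink R X U) => // x n.
have [m1 m1P] : exists m, U x m `<=` [set z | U z m `<=` U x n].
  apply: nbhs_of_compact_exhaustion (Ule x) (Ubase x) _ (Unbhs x n) _.
    by move=> i j ij z zi; apply: subset_trans zi; exact: Ule.
  by move=> K cK; exact: Uout.
have [m2 m2P] :
    exists m, U x m `<=` [set z | forall y, U y m z -> U x m1 y].
  apply: nbhs_of_compact_exhaustion (Ule x) (Ubase x) _ (Unbhs x m1) _.
    by move=> i j ij z zi y yz; apply: zi; exact: Ule yz.
  by move=> K cK; exact: Uin.
exists (maxn m1 m2) => y [z [xz yz]].
have xy : U x m1 y.
  by apply: (m2P z); [apply: Ule xz|apply: Ule yz]; exact: leq_maxr.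
by apply: subset_trans (m1P y xy); apply: Ule; exact: leq_maxl.
Qed.

End CompactUniform.

(** * From set-valued maps to a metric *)

Section Covers.
Variables (Y : topologicalType) (B : nat -> set Y).
Hypothesis hB : strictly_increasing_closed_cover B.

Let Bcover y : exists n, B n y.
Proof.
case: hB => _ BT _ _; have [n _ ny] : (\bigcup_n B n) y by rewrite BT.
by exists n.
Qed.

Let Ble m n : (m <= n)%N -> B m `<=` B n.
Proof.
case: hB => _ _ _ BS /subnK <-; elim: (n - m)%N => [//|k IH].
by apply: (subset_trans IH); have [] := BS (k + m)%N.
Qed.

Section ToMetrizable.
Variables (R : realType) (X : topologicalType) (phi : set X -> X -> set Y).
Hypotheses (hX : hausdorff_space X) (phiL : closed_sets_to_lsc phi)
  (phiU : unbounded_exactly_on B phi).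

Let nbh (x : X) (n : nat) : set X := weak_preimage (phi [set x]) (~` B n).

Lemma metrizable_unbounded_nbhs :
  (forall K O, compact K -> open O -> K `<=` O ->
     exists n, K `<=` [set z | forall y, nbh z n y -> O y]) ->
  (forall K O, compact K -> open O -> K `<=` O ->
     exists n, K `<=` [set z | forall y, nbh y n z -> O y]) ->
  metrizable R X.
Proof.
have closed1 (x : X) : closed [set x].
  by apply: compact_closed => //; exact: compact_set1.
apply: metrizable_compact_uniform_nbhs => // [x n|x n|x m n mn y].
- have [_] := phiL (closed1 x); apply.
  by case: hB => Bcl _ _ _; exact: closed_openC.
- have : [set x] x by [].
  by rewrite {1}(phiU (closed1 x)); apply.
- by move=> [z [zy nz]]; exists z; split => // /(Ble mn).
Qed.

Hypothesis phiM : monotone_in_set phi.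

Let phi1_sub F x y : closed F -> F x -> phi [set x] y `<=` phi F y.
Proof.
move=> Fcl Fx; apply: phiM => //; last by move=> _ ->.
by apply: compact_closed => //; exact: compact_set1.
Qed.

(** For z in K, monotonicity bounds phi_z by phi_K, which stays in B_n outside
    O; so phi_z can leave B_n only at points of O. *)
Lemma compact_bounded_nbhs : compact_bounded_on_closed B phi ->
  forall K O, compact K -> open O -> K `<=` O ->
  exists n, K `<=` [set z | forall y, nbh z n y -> O y].
Proof.
move=> phiK K O cK oO KO.
have [|n nP] := phiK K _ cK (open_closedC oO).
  by rewrite -subset0 => x [/KO].
exists n => z Kz y [w [zw nw]]; apply: contrapT => /nP yB.
by apply/nw/yB; apply: phi1_sub zw => //; exact: compact_closed.
Qed.

(** For y outside O, monotonicity bounds phi_y by phi_F with F the complement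
    of O, and phi_F stays in B_n on K. *)
Lemma closed_bounded_nbhs : closed_bounded_on_compact B phi ->
  forall K O, compact K -> open O -> K `<=` O ->
  exists n, K `<=` [set z | forall y, nbh y n z -> O y].
Proof.
move=> phiF K O cK oO KO.
have [|n nP] := phiF _ K (open_closedC oO) cK.
  by rewrite -subset0 => x [+ /KO].
exists n => z Kz y [w [zw nw]]; apply: contrapT => Oy; apply: nw.
by apply: (nP z Kz); apply: phi1_sub zw => //; exact: open_closedC.
Qed.

Lemma unbounded_nbhs_sym : symmetric_on_points phi ->
  forall n x y, nbh x n y -> nbh y n x.
Proof. by move=> phiC n x y; rewrite /nbh /weak_preimage/= phiC. Qed.

End ToMetrizable.

(** * Set-valued maps from decreasing open sets *)

Section FromDecreasingOpens.
Variables (X : topologicalType) (W : nat -> set X).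
Hypothesis Wopen : forall n, open (W n).
Hypothesis Wle : forall m n, (m <= n)%N -> W n `<=` W m.

(** Since the W k decrease, this is B k for the least k with x outside W k, and
    Y if x lies in all of them. Written as an intersection, it is visibly
    closed. *)
Definition cover_step (x : X) : set Y := \bigcap_(k in [set k | ~ W k x]) B k.

Lemma cover_step_closed : nonempty_closed_valued cover_step.
Proof.
case: hB => Bcl _ [y0 By0] _ x; split; last by apply: closed_bigI => k _.
by exists y0 => k _; exact: Ble By0.
Qed.

(** A point y belongs to [cover_step x] when x lies in W k for all k with y
    outside B k. As y belongs to some B N, only the k < N matter, and these are
    finitely many open conditions on x. *)
Lemma cover_step_lsc : lower_semicontinuous_map cover_step.
Proof.
move=> V oV; rewrite openE => x [y [xy Vy]].
have [N yN] := Bcover y.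
have : forall n, nbhs x [set x' | forall k, (k < n)%N -> ~ B k y -> W k x'].
  elim=> [|n IH]; first by apply: filterE.
  have xn : nbhs x [set x' | ~ B n y -> W n x'].
    have [yn|yn] := pselect (B n y); first by apply: filterE => x' /(_ yn).
    have xW : W n x by apply: contrapT => /xy.
    by apply: filterS (open_nbhs_nbhs (conj (Wopen n) xW)) => x' + _.
  apply: filterS (filterI IH xn) => x' [x'lt x'n] k.
  by rewrite ltnS leq_eqVlt => /orP[/eqP ->//|]; exact: x'lt.
move=> /(_ N); apply: filterS => x' x'N; exists y; split=> // k nWk.
apply: contrapT => nBk; apply/nWk/x'N => //.
by rewrite ltnNge; apply/negP => Nk; apply/nBk/(Ble Nk).
Qed.

(** For x in W n, a point of B n.+1 outside B n witnesses that [cover_step x]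
    leaves B n; this is where strictness of the cover matters. *)
Lemma weak_preimage_cover_step n : weak_preimage cover_step (~` B n) = W n.
Proof.
apply/seteqP; split=> x.
  by move=> [y [xy ny]]; apply: contrapT => /xy.
move=> Wx; case: hB => _ _ _ /(_ n)[_ /existsNP[y /not_implyP[yS ny]]].
exists y; split=> // k nWk; apply: Ble yS.
by rewrite ltnNge; apply/negP => /Wle/(_ _ Wx).
Qed.

Lemma bounded_cover_step (A : set X) n :
  W n `&` A = set0 -> bounded_map_on B cover_step A.
Proof.
move=> WA0; exists n => x Ax y xy; apply: contrapT => ny.
rewrite -[False]/(set0 x) -WA0 -weak_preimage_cover_step.
by split=> //; exists y.
Qed.

End FromDecreasingOpens.

(** * From a metric to set-valued maps *)

Section FromDistance.
Local Open Scope ring_scope.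
Variables (R : realType) (X : topologicalType) (d : X -> X -> R).
Hypotheses (dxx : forall x, d x x = 0) (dC : forall x y, d x y = d y x)
  (dD : forall y x z, d x z <= d x y + d y z)
  (nbhsd : forall x A, nbhs x A <->
     exists2 e : R, 0 < e & forall y, d x y < e -> A y).

Let thickening (F : set X) (n : nat) : set X :=
  [set x | exists2 y, F y & d y x < n.+1%:R^-1].

Let thickening_open F n : open (thickening F n).
Proof.
rewrite openE => x [y Fy yx]; apply/nbhsd.
exists (n.+1%:R^-1 - d y x) => [|z xz]; first by rewrite subr_gt0.
by exists y => //; rewrite (le_lt_trans (dD x y z))// -ltrBrDl.
Qed.

Let thickening_le F m n : (m <= n)%N -> thickening F n `<=` thickening F m.
Proof.
move=> mn x [y Fy yx]; exists y => //; apply: (lt_le_trans yx).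
by rewrite lef_pV2 ?posrE// ler_nat.
Qed.

Let invS_lt (e : R) : 0 < e -> exists n, n.+1%:R^-1 < e.
Proof.
move=> e0; exists (Num.truncn e^-1); rewrite invf_plt ?posrE//.
exact: truncnS_gt.
Qed.

Let thickening_bigcap F : closed F -> F = \bigcap_n thickening F n.
Proof.
move=> Fcl; apply/seteqP; split=> x.
  by move=> Fx n _; exists x => //; rewrite dxx invr_gt0 ltr0n.
move=> xF; apply: Fcl => A /nbhsd[e e0 eA]; have [n ne] := invS_lt e0.
have [y Fy yx] := xF n I; exists y; split=> //.
by apply: eA; rewrite dC (lt_trans yx).
Qed.

(** Near each point of K the distance to F has a positive lower bound;
    compactness makes the bound uniform. *)
Let compact_separation K F : compact K -> closed F -> K `&` F = set0 ->
  exists n, forall x y, K x -> F y -> ~ d x y < n.+1%:R^-1.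
Proof.
move=> cK Fcl KF0.
pose P n x := forall y, F y -> ~ d x y < n.+1%:R^-1.
suff [N _ NP] : \forall n \near \oo, K `<=` P n.
  by exists N => x y Kx; exact: (NP N (leqnn N)).
move/compact_near_coveringP: cK; apply=> x Kx.
have /nbhsd[e e0 eF] : nbhs x (~` F).
  apply: open_nbhs_nbhs; split; first exact: closed_openC.
  by move=> Fx; rewrite -[False]/(set0 x) -KF0.
have e20 : 0 < e / 2 by exact: divr_gt0.
have [N Ne] := invS_lt e20.
exists ([set x' | d x x' < e / 2], [set n | (N <= n)%N]) => /=.
  by split; [apply/nbhsd; exists (e / 2)|exists N].
move=> [x' n] /= [xx' Nn] y Fy x'y; apply: (eF y) Fy.
rewrite (le_lt_trans (dD x' x y))// [ltRHS]splitr ltrD// (lt_trans _ Ne)//.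
by apply: (lt_le_trans x'y); rewrite lef_pV2 ?posrE// ler_nat.
Qed.

Lemma exists_phi_of_distance : exists phi : set X -> X -> set Y,
  [/\ [/\ closed_sets_to_lsc phi, unbounded_exactly_on B phi &
          monotone_in_set phi],
      symmetric_on_points phi, compact_bounded_on_closed B phi &
      closed_bounded_on_compact B phi].
Proof.
exists (fun F => cover_step (thickening F)); split; first split.
- by move=> F _; split; [exact: cover_step_closed|exact: cover_step_lsc].
- move=> F Fcl; rewrite {1}(thickening_bigcap Fcl); apply: eq_bigcapr => n _.
  by rewrite (weak_preimage_cover_step (@thickening_le F)).
- move=> F1 F2 _ _ F12 x y xy k nW; apply: xy => -[z /F12 Fz zx].
  by apply: nW; exists z.
- have sym x y n : thickening [set x] n y -> thickening [set y] n x.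
    by move=> [_ -> xy]; exists y => //; rewrite dC.
  by move=> x y; apply/seteqP; split=> z xy k nW; apply: xy => /sym.
- move=> K F cK Fcl KF0; have [n nKF] := compact_separation cK Fcl KF0.
  apply: (bounded_cover_step (@thickening_le K) (n := n)).
  by rewrite -subset0 => x [[y Ky yx] Fx]; exact: nKF yx.
- move=> F K Fcl cK FK0; rewrite setIC in FK0.
  have [n nKF] := compact_separation cK Fcl FK0.
  apply: (bounded_cover_step (@thickening_le F) (n := n)).
  by rewrite -subset0 => x [[y Fy yx] Kx]; apply: (nKF x y) => //; rewrite dC.
Qed.

End FromDistance.
End Covers.

(** Pulling the distance back to X lets the construction of phi take place on
    X itself. *)
Lemma metrizable_distance (R : realType) (X : topologicalType) :
  metrizable R X -> exists d : X -> X -> R,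
    [/\ forall x, d x x = 0%R, forall x y, d x y = d y x,
        forall y x z, (d x z <= d x y + d y z)%R &
        forall x A, nbhs x A <->
          exists2 e : R, (0 < e)%R & forall y, (d x y < e)%R -> A y].
Proof.
move=> [M [f [g [fK gK cf cg]]]]; exists (fun x y => mdist (f x) (f y)); split.
- by move=> x; exact: mdistxx.
- by move=> x y; exact: metric_sym.
- by move=> y x z; exact: metric_triangle.
- move=> x A; split=> [xA|[e e0 eA]].
    have /nbhs_ballP[e e0 eA] : nbhs (f x) (g @^-1` A).
      by apply: (cg (f x) A); rewrite fK.
    by exists e => // y xy; rewrite -(fK y); apply: eA; rewrite ballEmdist.
  have : nbhs x (f @^-1` ball (f x) e) by apply: cf; exact: nbhsx_ballx.
  apply: filterS => y.
  by rewrite /= ballEmdist; exact: eA.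
Qed.

Theorem theorem4p7 (R : realType) (X Y : topologicalType) (B : nat -> set Y)
    (hX : hausdorff_space X) (hY : hausdorff_space Y)
    (hB : strictly_increasing_closed_cover B) :
  [<-> (* a *)
       metrizable R X;
       (* b *)
       exists phi : set X -> X -> set Y,
         [/\ closed_sets_to_lsc phi,
             unbounded_exactly_on B phi,
             monotone_in_set phi,
             symmetric_on_points phi &
             compact_bounded_on_closed B phi];
       (* c *)
       exists phi : set X -> X -> set Y,
         [/\ closed_sets_to_lsc phi,
             unbounded_exactly_on B phi,
             monotone_in_set phi,
             symmetric_on_points phi &
             closed_bounded_on_compact B phi];
       (* d *)
       exists phi : set X -> X -> set Y,
         [/\ closed_sets_to_lsc phi,
             unbounded_exactly_on B phi,
             monotone_in_set phi,
             compact_bounded_on_closed B phi &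
             closed_bounded_on_compact B phi]].
Proof.
have ex_phi : metrizable R X -> exists phi : set X -> X -> set Y,
    [/\ [/\ closed_sets_to_lsc phi, unbounded_exactly_on B phi &
            monotone_in_set phi],
        symmetric_on_points phi, compact_bounded_on_closed B phi &
        closed_bounded_on_compact B phi].
  move=> /metrizable_distance[d [dxx dC dD nbhsd]].
  exact: (exists_phi_of_distance hB dxx dC dD nbhsd).
(* The data in (b) and (c) are each used only to metrize X; the map required by
   the next item is then built anew from a metric. *)
tfae.
- by move=> /ex_phi[phi [[]]]; exists phi.
- move=> [phi [phiL phiU phiM phiC phiK]].
  suff /ex_phi[psi [[]]] : metrizable R X by exists psi.
  have Kout := compact_bounded_nbhs hX phiM phiK.
  apply: (metrizable_unbounded_nbhs hB R hX phiL phiU Kout) => K O cK oO KO.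
  have [n nP] := Kout K O cK oO KO; exists n => z /nP zn y.
  by move=> /(unbounded_nbhs_sym phiC); exact: zn.
- move=> [phi [phiL phiU phiM phiC phiF]].
  suff /ex_phi[psi [[]]] : metrizable R X by exists psi.
  have Kin := closed_bounded_nbhs hX phiM phiF.
  apply: (metrizable_unbounded_nbhs hB R hX phiL phiU _ Kin) => K O cK oO KO.
  have [n nP] := Kin K O cK oO KO; exists n => z /nP zn y.
  by move=> /(unbounded_nbhs_sym phiC); exact: zn.
- move=> [phi [phiL phiU phiM phiK phiF]].
  exact: (metrizable_unbounded_nbhs hB R hX phiL phiU
    (compact_bounded_nbhs hX phiM phiK) (closed_bounded_nbhs hX phiM phiF)).
Qed.
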